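(* (i) Let $p$ be a prime with $p = 8a^2+1 = 64b^2+9$ for some odd integers $a,b$, and let $D \subset \mathbb{Z}/p\mathbb{Z}$ be the set of nonzero octic residues modulo $p$ (the type $O$ difference set). Then $D\cup\{0\}$ is an almost difference set in the additive group $\mathbb{Z}/p\mathbb{Z}$. (ii) Let $p$ be a prime with $p = 8a^2+49 = 64b^2+441$ for some odd integer $a$ and even integer $b$, and let $D \subset \mathbb{Z}/p\mathbb{Z}$ be the set consisting of $0$ and the nonzero octic residues modulo $p$ (the type $O_0$ difference set). Then $D\setminus\{0\}$ is an almost difference set in the additive group $\mathbb{Z}/p\mathbb{Z}$.
   Context: The nonzero octic residues modulo a prime $p$ are the elements $x^8$ with $x\in(\mathbb{Z}/p\mathbb{Z})^*$. For a finite group $G$ of order $v$ (written additively), a $k$-subset $D$ of $G$ is a $(v,k,\lambda)$-difference set if every nonzero element of $G$ occurs exactly $\lambda$ times as a difference $d-d'$ with $d,d'\in D$. A $k$-subset $D$ of $G$ is a $(v,k,\lambda,t)$-almost difference set if exactly $t$ nonzero elements of $G$ occur exactly $\lambda$ times as differences $d-d'$ with $d,d'\in D$, and the other $v-1-t$ nonzero elements occur exactly $\lambda+1$ times. A set is an almost difference set if it is a $(v,k,\lambda,t)$-almost difference set for some $\lambda$ and $t$. It is a known fact (M. Hall) that for primes $p$ as in (i), respectively (ii), the set $D$ described there is a difference set in $\mathbb{Z}/p\mathbb{Z}$; these are called difference sets of type $O$, respectively type $O_0$. *)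

(* Defs.v *)
From HB Require Import structures.
From mathcomp Require Import all_boot all_order all_algebra.

Set Implicit Arguments.
Unset Strict Implicit.
Unset Printing Implicit Defensive.

Import GRing.Theory.
Local Open Scope ring_scope.

Definition diff_count (G : finZmodType) (D : {set G}) (g : G) : nat :=
  #|[set d : G * G | [&& d.1 \in D, d.2 \in D & d.1 - d.2 == g]]|.

(* By the third and fourth clauses, the v - 1 - t nonzero elements not occurring
   lam times occur lam + 1 times. *)
Definition is_almost_difference_set (G : finZmodType) (v k lam t : nat)
    (D : {set G}) : Prop :=
  [/\ #|G| = v, #|D| = k,
      #|[set g : G | (g != 0) && (diff_count D g == lam)]| = t
    & forall g : G, g != 0 -> diff_count D g <> lam -> diff_count D g = lam.+1].

Definition almost_difference_set (G : finZmodType) (D : {set G}) : Prop :=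
  exists lam t : nat, is_almost_difference_set #|G| #|D| lam t D.

(* 'F_p is Z/pZ only when p is prime. *)
Definition octic_residues (p : nat) : {set 'F_p} :=
  [set x ^+ 8 | x : 'F_p & x \is a GRing.unit].

Definition type_O (p : nat) : {set 'F_p} := octic_residues p.

Definition type_O0 (p : nat) : {set 'F_p} := 0 |: octic_residues p.

(* Main.v *)
Require Import Defs.
From mathcomp Require Import all_boot all_order all_algebra all_field.
From mathcomp Require Import cyclic.
From mathcomp Require Import zify ring.

Set Implicit Arguments.
Unset Strict Implicit.
Unset Printing Implicit Defensive.

Import Order.TTheory GRing.Theory Num.Theory.
Local Open Scope ring_scope.

(** Let [p = 8 f + 1] with [f] odd, let [D] be the set of octic residues and let
    [N t] be the number of representations of [t] as a difference of two elements
    of [D]. Since [-1] is a fourth power but not an eighth power, the fourth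
    powers are the disjoint union of [D] and [- D]. As [N t = N (- t)], scaling
    gives [2 N t = #{d in D : psi (1 - d) = psi t}] for a quartic character
    [psi] ([diff_count_psi]), and Fourier inversion shows that
    [8 N t = f - 1 - s + 4 s [t in D or - t in D]] as soon as the sums of
    [psi (1 - x^8)] and of [phi (1 - x^8)], where [phi = psi^2], both equal
    [8 s + 1] ([diff_count_octics]). For [s = 0] the count is constant, and
    adjoining 0 to [D] raises it by one exactly on [D] and [- D]. For [s = -2]
    the count is smaller by one exactly there. In both cases the counts for
    the set of the theorem take two consecutive values.

    The two character sums are computed from the Jacobsthal sums
    [2 X = sum of phi x * phi (x^2 + 1)] and [4 u = sum of phi x * phi (x^4 + 1)].
    Their mean squares give [p = X^2 + 4 Y^2] and [p = u^2 + 2 v^2], and a count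
    of orbits gives [X = 3] and [u = 1] modulo 4 ([jacobsthal2_norm_form],
    [jacobsthal4_norm_form]). A prime has at most one representation by each
    form ([norm_form_unique]), so the hypotheses, which read
    [p = (4 s + 1)^2 + 8 a^2 = (12 s + 3)^2 + 64 b^2], determine [u = 4 s + 1]
    and [X = 12 s + 3] including signs. The quadratic sum is [2 X - 4 u - 1]
    ([sum_phi_octic]).

    The quartic sum equals [2 pi - 1 + A + B], where [pi] is the Jacobi sum of
    [phi] and [psi], and [A], [B] are the sums of [psi (z (1 - z^2))] and
    [psi ((1 - z^2) / z)]. Passing to the coordinate [w = (z - 1/z) / 2] gives
    [A = - 2 psi(2) pi] and [B = 2 psi(2) u] ([sum_psi_cubicE],
    [sum_psi_quotientE]). Finally [psi 2 = 1]: the number of [t] such that [t]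
    and [1 - t] are both nonzero fourth powers is [(p - 11 + 6 X) / 16], which
    is odd, so the involution [t -> 1 - t] has the fixed point [1 / 2] among
    them. Hence [pi] cancels and the quartic sum is [2 u - 1 = 8 s + 1]. *)

(** * Finite fields, powers of i, and representations by binary forms *)

Lemma finField_prim_root (F : finFieldType) :
  exists g : F, (#|F|.-1).-primitive_root g.
Proof.
have q_gt1 := finNzRing_gt1 F; pose rs := [seq x <- enum F | x != 0].
have /hasP[g _ ?] : has (#|F|.-1).-primitive_root rs; last by exists g.
apply: has_prim_root.
- by rewrite -subn1 subn_gt0.
- apply/allP => x; rewrite mem_filter => /andP[x0 _].
  rewrite unity_rootE; apply/eqP/(mulfI x0).
  by rewrite -exprS prednK ?expf_card ?mulr1 // ltnW.
- by rewrite filter_uniq ?enum_uniq.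
- rewrite -(cardC1 (0 : F)) size_filter cardE size_filter enumT.
  by rewrite leq_eqVlt; apply/orP; left; apply/eqP/eq_count.
Qed.

(** A fibre of the n-th power map is a coset of the n-th roots of unity. *)
Lemma card_expr_fiber (F : finFieldType) (n : nat) (z y : F) :
  n.-primitive_root z -> y != 0 -> #|[set x | x ^+ n == y ^+ n]| = n.
Proof.
move=> zP y0; have n0 := prim_order_gt0 zP.
rewrite -[RHS]card_ord -(card_imset (mem 'I_n) (f := fun i : 'I_n => y * z ^+ i)).
  apply: eq_card => x; rewrite !inE; apply/eqP/imsetP => [xy|[i _ ->]].
    have /(prim_rootP zP)[i xE] : (x / y) ^+ n = 1.
      by rewrite expr_div_n xy divff ?expf_neq0.
    by exists i => //; rewrite -xE mulrC divfK.
  by rewrite exprMn -exprM mulnC exprM (prim_expr_order zP) expr1n mulr1.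
move=> i j /(mulfI y0)/eqP; rewrite (eq_prim_root_expr zP) !modn_small //.
by move=> /eqP/val_inj.
Qed.

Lemma big_1_5 (R : nmodType) (h : nat -> R) :
  \sum_(1 <= j < 5) h j = h 1%N + h 2%N + h 3%N + h 4%N.
Proof. by rewrite unlock /= addr0 !addrA. Qed.

Lemma expi4 : 'i ^+ 4 = 1 :> algC.
Proof. by rewrite (exprM _ 2 2) sqrCi sqrrN expr1n. Qed.

Lemma signC_eq1 k : ((-1) ^+ k == 1 :> algC) = ~~ odd k.
Proof.
rewrite -signr_odd; case: odd; rewrite ?expr0 ?eqxx // expr1.
by rewrite -subr_eq0 -opprD oppr_eq0 -[1 + 1]/(2%:R) pnatr_eq0.
Qed.

Lemma expi_eq1 k : ('i ^+ k == 1 :> algC) = (4 %| k)%N.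
Proof.
apply/eqP/dvdnP => [ik|[j ->]]; last by rewrite mulnC exprM expi4 expr1n.
have /eqP : ('i ^+ k) ^+ 2 = 1 :> algC by rewrite ik expr1n.
rewrite exprAC sqrCi signC_eq1 -dvdn2 => /dvdnP[j kE].
move/eqP: ik; rewrite kE mulnC exprM sqrCi signC_eq1 -dvdn2 => /dvdnP[i ->].
by exists i; rewrite mulnCA mulnA mulnC.
Qed.

Lemma even_of_sqr (w n : int) : w ^+ 2 = 2 * n -> exists w1, w = 2 * w1.
Proof.
have [j [r [-> [->|->]]]] : exists j r, w = 2 * j + r /\ (r = 0 \/ r = 1).
  by exists (w %/ 2)%Z, (w %% 2)%Z; lia.
- by exists j; rewrite addr0.
- have -> : (2 * j + 1) ^+ 2 = 2 * (2 * j ^+ 2 + 2 * j) + 1 by ring.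
  move: (2 * j ^+ 2 + 2 * j) => m; lia.
Qed.

(** Both representations are multiplied in the two ways given by Brahmagupta's
    identity,
    [p^2 = (ac + kbd)^2 + k (ad - bc)^2 = (ac - kbd)^2 + k (ad + bc)^2],
    while [p] divides [(ad - bc)(ad + bc)]. The factor that [p] divides must
    vanish because [k > 1] leaves no room for [k p^2] in [p^2]. The case
    [k = 1] fails only by exchanging the two squares; sums of two squares are
    therefore handled below with [k = 4], the even square being written
    [4 Y^2]. *)
Lemma norm_form_unique (p : nat) (k a b c d : int) : prime p -> 1 < k ->
  p%:Z = a ^+ 2 + k * b ^+ 2 -> p%:Z = c ^+ 2 + k * d ^+ 2 -> a ^+ 2 = c ^+ 2.
Proof.
move=> pP k1 E1 E2.
have p0 : p%:Z != 0 by rewrite eqz_nat -lt0n prime_gt0.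
have ppos : 0 < p%:Z :> int by rewrite ltz_nat prime_gt0.
have D : (p%:Z %| (a * d - b * c) * (a * d + b * c))%Z.
  apply/dvdzP; exists (d ^+ 2 - b ^+ 2).
  transitivity ((a ^+ 2) * d ^+ 2 - b ^+ 2 * c ^+ 2); first by ring.
  have -> : a ^+ 2 = p%:Z - k * b ^+ 2 by rewrite E1; ring.
  have -> : c ^+ 2 = p%:Z - k * d ^+ 2 by rewrite E2; ring.
  by ring.
have key e x : p%:Z ^+ 2 = x ^+ 2 + k * (e * p%:Z) ^+ 2 -> e = 0.
  move=> h; apply/eqP/negPn/negP => e0.
  have n0 : 0 < e ^+ 2 by rewrite lt0r sqr_ge0 sqrf_eq0 e0.
  have : k * e ^+ 2 * p%:Z ^+ 2 <= 1 * p%:Z ^+ 2.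
    by rewrite mul1r -mulrA -exprMn h lerDr sqr_ge0.
  rewrite ler_pM2r ?exprn_gt0 //; move: (e ^+ 2) n0 => n n0 kn.
  by clear -k1 kn n0; nia.
have zero : a ^+ 2 * d ^+ 2 = b ^+ 2 * c ^+ 2.
  have prod : p%:Z ^+ 2 = (a ^+ 2 + k * b ^+ 2) * (c ^+ 2 + k * d ^+ 2).
    by rewrite -E1 -E2 expr2.
  have pr : (p%:Z %| a * d - b * c)%Z || (p%:Z %| a * d + b * c)%Z.
    by move: D; rewrite !dvdzE abszM Euclid_dvdM.
  have : a * d - b * c = 0 \/ a * d + b * c = 0.
    case/orP: pr => /dvdzP[e eE]; [left|right]; rewrite eE.
  - by rewrite (key e (a * c + k * b * d)) ?mul0r // prod -eE; ring.
  - by rewrite (key e (a * c - k * b * d)) ?mul0r // prod -eE; ring.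
  case=> h.
    have -> : a ^+ 2 * d ^+ 2 = (a * d - b * c + b * c) ^+ 2 by ring.
    by rewrite h; ring.
  have -> : a ^+ 2 * d ^+ 2 = (a * d + b * c - b * c) ^+ 2 by ring.
  by rewrite h; ring.
apply: (mulfI p0).
transitivity (c ^+ 2 * a ^+ 2 + k * (a ^+ 2 * d ^+ 2)); first by rewrite E2; ring.
by rewrite zero E1; ring.
Qed.

(** * The quartic and the quadratic character *)

Section Characters.

Variables (F : finFieldType) (f : nat) (g : F).
Hypotheses (cardF : #|F| = (8 * f).+1) (f_odd : odd f).
Hypothesis gP : (8 * f).-primitive_root g.

Let f_gt0 : (0 < f)%N. Proof. by case: f f_odd. Qed.

Let f_half : f = (2 * f./2).+1%N.
Proof. by rewrite -{1}(odd_double_half f) f_odd mul2n. Qed.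

Definition dlog (x : F) : nat := index x [seq g ^+ k | k <- iota 0 #|F|].

Lemma dlogK x : x != 0 -> g ^+ dlog x = x.
Proof.
move=> x0; have x1 : x ^+ (8 * f) = 1.
  by apply: (mulfI x0); rewrite -exprS -cardF expf_card mulr1.
have [i xE] := prim_rootP gP x1.
have xs : x \in [seq g ^+ k | k <- iota 0 #|F|].
  by rewrite xE map_f // mem_iota add0n cardF (leq_trans (ltn_ord i)) /=.
have lt : (index x [seq g ^+ k | k <- iota 0 #|F|] < size (iota 0 #|F|))%N.
  by move: xs; rewrite -index_mem size_map.
rewrite -[RHS](nth_index 0 xs) (nth_map 0%N) // nth_iota //.
by rewrite size_iota in lt.
Qed.

Lemma g_neq0 : g != 0.
Proof.
apply/eqP => g0; have := prim_expr_order gP.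
by move/eqP; rewrite g0 expr0n muln_eq0 /= eqn0Ngt f_gt0 /= eq_sym oner_eq0.
Qed.

Definition quartic_char (x : F) : algC := if x == 0 then 0 else 'i ^+ dlog x.
Local Notation psi := quartic_char.

Lemma psi0 : psi 0 = 0. Proof. by rewrite /psi eqxx. Qed.

Lemma psi_expg k : psi (g ^+ k) = 'i ^+ k.
Proof.
rewrite /psi expf_eq0 (negPf g_neq0) andbF.
have /eqP := dlogK (expf_neq0 k g_neq0); rewrite (eq_prim_root_expr gP).
move=> /eqP e.
rewrite -(expr_mod (dlog _) expi4) -(expr_mod k expi4).
congr (_ ^+ _).
have d : (4 %| 8 * f)%N by rewrite -(mulnA 4 2) dvdn_mulr.
by rewrite -(modn_dvdm (dlog _) d) e modn_dvdm.
Qed.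

Lemma psiM x y : psi (x * y) = psi x * psi y.
Proof.
have [->|x0] := eqVneq x 0; first by rewrite mul0r psi0 mul0r.
have [->|y0] := eqVneq y 0; first by rewrite mulr0 psi0 mulr0.
by rewrite -(dlogK x0) -(dlogK y0) -exprD !psi_expg exprD.
Qed.

Lemma psi1 : psi 1 = 1. Proof. exact: (psi_expg 0). Qed.
Lemma psig : psi g = 'i. Proof. exact: (psi_expg 1). Qed.

Lemma psiX x n : psi (x ^+ n) = psi x ^+ n.
Proof. by elim: n => [|n IHn]; rewrite ?psi1 // !exprS psiM IHn. Qed.

Lemma psi_eq0 x : (psi x == 0) = (x == 0).
Proof.
by rewrite /psi; case: ifP; rewrite ?eqxx // expf_eq0 (negPf (neq0Ci _)) andbF.
Qed.

(** From here on powers of [psi] replace conjugates and inverses: [psi ^ 2] is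
    the quadratic character, [psi ^ 3] the conjugate character, and [psi ^ 4]
    the indicator of the nonzero elements. *)
Lemma psi4 x : x != 0 -> psi x ^+ 4 = 1.
Proof. by move=> x0; rewrite -(dlogK x0) psi_expg exprAC expi4 expr1n. Qed.

Lemma psi_exp5 x : psi x ^+ 5 = psi x.
Proof.
have [->|x0] := eqVneq x 0; first by rewrite psi0 expr0n.
by rewrite exprS psi4 // mulr1.
Qed.

Lemma psiV x : psi x^-1 = psi x ^+ 3.
Proof.
have [->|x0] := eqVneq x 0; first by rewrite invr0 psi0 expr0n.
have p0 : psi x != 0 by rewrite psi_eq0.
by apply: (mulfI p0); rewrite -psiM divff // psi1 -exprS psi4.
Qed.

Lemma psi_conj x : (psi x)^* = psi x ^+ 3.
Proof.
have [->|x0] := eqVneq x 0; first by rewrite psi0 conjC0 expr0n.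
rewrite -(dlogK x0) psi_expg rmorphXn /= conjCi exprAC.
by rewrite [in RHS]exprS sqrCi mulrN1.
Qed.

Definition quadratic_char (x : F) : int :=
  if x == 0 then 0 else if odd (dlog x) then -1 else 1.
Local Notation phi := quadratic_char.

(** [phi] is kept integer valued, because parity and congruence arguments are
    made about its sums; this identity carries it to the complex numbers. *)
Lemma phiE x : (phi x)%:~R = psi x ^+ 2.
Proof.
rewrite /phi /psi; case: ifP => _; first by rewrite expr0n.
rewrite exprAC sqrCi -signr_odd; case: odd; rewrite ?expr1 ?expr0 //.
Qed.

Lemma intC_inj (m n : int) : m%:~R = n%:~R :> algC -> m = n.
Proof. by move/intr_inj. Qed.

Lemma phi0 : phi 0 = 0. Proof. by rewrite /phi eqxx. Qed.
Lemma phiM x y : phi (x * y) = phi x * phi y.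
Proof. by apply/intC_inj; rewrite rmorphM /= !phiE psiM exprMn. Qed.
Lemma phi1 : phi 1 = 1.
Proof. by apply/intC_inj; rewrite phiE psi1 expr1n. Qed.
Lemma phiX x n : phi (x ^+ n) = phi x ^+ n.
Proof. by elim: n => [|n IHn]; rewrite ?phi1 // !exprS phiM IHn. Qed.
Lemma phi_sq x : x != 0 -> phi x ^+ 2 = 1.
Proof. by move=> x0; apply/intC_inj; rewrite rmorphXn /= phiE -exprM psi4. Qed.
Lemma phi_sign x : x != 0 -> phi x = 1 \/ phi x = -1.
Proof. by rewrite /phi => /negPf->; case: odd; [right|left]. Qed.
Lemma phiV x : phi x^-1 = phi x.
Proof.
have [->|x0] := eqVneq x 0; first by rewrite invr0.
have := phi_sq x0; rewrite expr2 => e.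
have : phi x * phi x^-1 = phi x * phi x by rewrite e -phiM divff // phi1.
by move/mulfI; apply; case: (phi_sign x0) => ->.
Qed.
Lemma phig : phi g = -1.
Proof. by apply/intC_inj; rewrite phiE psig sqrCi rmorphN. Qed.

Lemma phi_sqr x : phi x = 1 -> exists2 y, y != 0 & x = y ^+ 2.
Proof.
rewrite {1}/phi; case: eqVneq => // x0; case: ifP => // o _.
exists (g ^+ (dlog x)./2); first by rewrite expf_neq0 ?g_neq0.
rewrite -exprM muln2 -[RHS]mul1r -(expr0 g) -exprD.
by rewrite -[X in (X + _)%N]/(false : nat) -o odd_double_half dlogK.
Qed.

Definition zeta8 := g ^+ f.
Definition zeta4 := g ^+ (2 * f).

Lemma zeta8P : 8.-primitive_root zeta8.
Proof. by have := dvdn_prim_root gP (dvdn_mulr f (dvdnn 8)); rewrite mulKn. Qed.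
Lemma zeta4P : 4.-primitive_root zeta4.
Proof.
have d : (4 %| 8 * f)%N by rewrite -(mulnA 4 2) dvdn_mulr.
by have := dvdn_prim_root gP d; rewrite -(mulnA 4 2) mulKn.
Qed.
Lemma zeta8_sq : zeta8 ^+ 2 = zeta4. Proof. by rewrite -exprM mulnC. Qed.
Lemma zeta4_sq : zeta4 ^+ 2 = -1.
Proof.
have /eqP : (zeta4 ^+ 2) ^+ 2 = 1 by rewrite -exprM (prim_expr_order zeta4P).
by rewrite sqrf_eq1 -(prim_order_dvd zeta4P) /= => /eqP.
Qed.
Lemma psiN1 : psi (-1) = 1.
Proof. by rewrite -zeta4_sq -!exprM psi_expg mulnAC exprM expi4 expr1n. Qed.
Lemma psiN x : psi (- x) = psi x.
Proof. by rewrite -mulN1r psiM psiN1 mul1r. Qed.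
Lemma phiN x : phi (- x) = phi x.
Proof. by apply/intC_inj; rewrite !phiE psiN. Qed.
(** This is the place where [f] odd matters: [zeta4 = g ^ (2f)] is a square but
    not a fourth power, and [zeta8 = g ^ f] is not even a square. *)
Lemma psi_zeta4 : psi zeta4 = -1.
Proof. by rewrite psi_expg exprM sqrCi -signr_odd f_odd expr1. Qed.
Lemma phi_zeta4 : phi zeta4 = 1.
Proof. by apply/intC_inj; rewrite phiE psi_zeta4 sqrrN expr1n. Qed.
Lemma phi_zeta8 : phi zeta8 = -1.
Proof.
apply/intC_inj.
by rewrite phiE psi_expg exprAC sqrCi -signr_odd f_odd expr1 rmorphN.
Qed.
Lemma zeta8_neq0 : zeta8 != 0. Proof. by rewrite expf_neq0 ?g_neq0. Qed.
Lemma zeta4_neq0 : zeta4 != 0. Proof. by rewrite expf_neq0 ?g_neq0. Qed.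

Lemma two_neq0 : 2%:R != 0 :> F.
Proof.
have : zeta4 ^+ 2 != 1 by rewrite -(prim_order_dvd zeta4P).
rewrite zeta4_sq; apply: contra => /eqP e.
by rewrite -subr_eq0 -opprD -mulr2n e oppr0.
Qed.

(** If [z] is a primitive eighth root of unity, then [z - z^3 = z + z^-1] is a
    square root of 2. *)
Lemma phi2 : phi 2%:R = 1.
Proof.
have z0 := zeta8_neq0; have z4 := zeta4_sq; rewrite -zeta8_sq in z4.
have E : 2%:R = (zeta8 - zeta8 ^+ 3) ^+ 2 by ring: z4.
have := two_neq0; rewrite E expf_eq0 /= => n0.
by rewrite phiX phi_sq.
Qed.

(** * Sums over squares and over fibres of squaring *)

Lemma sum_scale_eq0 (R : idomainType) (h : F -> R) (c : F) (a : R) :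
  c != 0 -> a != 1 -> (forall x, h (c * x) = a * h x) -> \sum_x h x = 0.
Proof.
move=> c0 a1 hE; apply/eqP; have : (1 - a) * \sum_x h x = 0.
  rewrite mulrBl mul1r {1}(reindex_inj (mulfI c0)) /= mulr_sumr.
  by apply/eqP; rewrite subr_eq0; apply/eqP/eq_bigr => x _; rewrite hE.
by move/eqP; rewrite mulf_eq0 subr_eq0 eq_sym (negPf a1).
Qed.

Lemma sum_phi : \sum_x phi x = 0.
Proof.
by apply: (@sum_scale_eq0 _ _ g (-1)) => [||x]; rewrite ?g_neq0 // phiM phig.
Qed.

Lemma sum_psi : \sum_x psi x = 0.
Proof.
apply: (@sum_scale_eq0 _ _ zeta4 (-1)) => [||x]; rewrite ?zeta4_neq0 //.
  by rewrite -[-1]expr1 signC_eq1.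
by rewrite psiM psi_zeta4.
Qed.

Lemma sum_sqr_fiber (R : nmodType) (y0 : F) (h : F -> R) : y0 != 0 ->
  \sum_(y | y ^+ 2 == y0 ^+ 2) h y = h y0 + h (- y0).
Proof.
move=> y00; have n : - y0 != y0.
  rewrite eq_sym -subr_eq0 opprK -mulr2n -mulr_natl.
  by rewrite mulf_neq0 ?two_neq0.
rewrite (eq_bigl (fun y => (y == y0) || (y == - y0))); last first.
  by move=> y; rewrite eqf_sqr.
rewrite (bigD1 y0) ?eqxx //= (bigD1 (- y0)) ?eqxx ?orbT ?n //= big1 ?addr0 //.
by move=> y; case: (y == y0); case: (y == -y0).
Qed.

Lemma sum_sqr_fiber0 (R : nmodType) (h : F -> R) :
  \sum_(y : F | y ^+ 2 == 0) h y = h 0.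
Proof. by rewrite (big_pred1 0) // => y; rewrite expf_eq0. Qed.

Lemma sum_sqr_fiber_nonsquare (R : nmodType) (x : F) (h : F -> R) :
  phi x = -1 -> \sum_(y : F | y ^+ 2 == x) h y = 0.
Proof.
move=> px; apply: big_pred0 => y; apply/eqP => yx; move: px; rewrite -yx.
have [->|/phi_sq] := eqVneq y 0; first by rewrite expr0n phi0.
by rewrite phiX => ->.
Qed.

Lemma sum1_sqr_fiber (R : pzRingType) (x : F) :
  \sum_(y : F | y ^+ 2 == x) 1 = 1 + (phi x)%:~R :> R.
Proof.
have [->|x0] := eqVneq x 0; first by rewrite sum_sqr_fiber0 phi0 addr0.
have [/phi_sqr[y0 y00 ->]|px] := phi_sign x0.
  by rewrite sum_sqr_fiber // phiX phi_sq.
by rewrite sum_sqr_fiber_nonsquare // px subrr.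
Qed.

(** A sum over squares [y^2] visits [x] exactly [1 + phi x] times. *)
Lemma sum_over_squares (R : comPzRingType) (h : F -> R) :
  \sum_y h (y ^+ 2) = \sum_x h x + \sum_x (phi x)%:~R * h x.
Proof.
rewrite -big_split (partition_big (fun y : F => y ^+ 2) predT) //=.
apply: eq_bigr => x _.
rewrite (eq_bigr (fun=> h x * 1)) => [|y /eqP->]; last by rewrite mulr1.
by rewrite -mulr_sumr sum1_sqr_fiber mulrDr mulr1 [X in _ + X]mulrC.
Qed.

Lemma sum_over_squares_int (h : F -> int) :
  \sum_y h (y ^+ 2) = \sum_x h x + \sum_x phi x * h x.
Proof.
rewrite sum_over_squares; congr (_ + _).
by apply: eq_bigr => x _; rewrite intz.
Qed.

(** The fibre over [x = y^2] contributes [phi y + phi (-y) = 2 phi y], and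
    [phi y] is [psi (y^2) = psi x]; on nonsquares [psi ^ 2 = -1] makes
    [psi + psi ^ 3] vanish. *)
Lemma sum_phi_over_squares (h : F -> algC) :
  \sum_y (phi y)%:~R * h (y ^+ 2) = \sum_x (psi x + psi x ^+ 3) * h x.
Proof.
rewrite (partition_big (fun y : F => y ^+ 2) predT) //=.
apply: eq_bigr => x _.
rewrite (eq_bigr (fun y => (phi y)%:~R * h x)) => [|y /eqP-> //].
rewrite -mulr_suml; congr (_ * _).
have [->|x0] := eqVneq x 0.
  by rewrite sum_sqr_fiber0 phi0 psi0 expr0n addr0.
have [/phi_sqr[y0 y00 ->]|px] := phi_sign x0.
  rewrite sum_sqr_fiber // phiN psiX -phiE; congr (_ + _).
  by rewrite -rmorphXn /= exprS phi_sq // mulr1.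
rewrite sum_sqr_fiber_nonsquare // exprS -phiE px.
by rewrite rmorphN mulrN1 subrr.
Qed.

(** * The quartic character sum over 1 - x^8 *)

(** By the next two lemmas this is the Jacobi sum [J(phi, psi) = J(psi, psi)],
    the Gaussian integer of norm [#|F|] attached to [psi]. Only its real part is
    ever needed, since it cancels from the quartic sum over [1 - x^8]. *)
Definition jacobi_pi : algC := \sum_z psi (1 - z ^+ 2).
Definition sum_psi_cubic := \sum_z psi (z * (1 - z ^+ 2)).
Definition sum_psi_quotient := \sum_z psi z ^+ 3 * psi (1 - z ^+ 2).

Lemma sum_phi_psi_compl : \sum_t (phi t)%:~R * psi (1 - t) = jacobi_pi.
Proof.
rewrite /jacobi_pi (sum_over_squares (fun t => psi (1 - t))).
rewrite [X in _ = X + _](_ : _ = 0) ?add0r //.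
by have := sum_psi; rewrite (reindex_inj (subrI 1)).
Qed.

(** Completing the square with [t = (1 + z) / 2] turns [t (1 - t)] into
    [(1 - z^2) / 4], and [psi 4 = phi 2 = 1]. *)
Lemma sum_psi_psi_compl : \sum_t psi t * psi (1 - t) = jacobi_pi.
Proof.
have h2 := two_neq0.
have i2 : 2%:R^-1 != 0 :> F by rewrite invr_eq0.
rewrite (reindex_inj (mulfI i2)) (reindex_inj (addrI 1)) /=.
apply: eq_bigr => z _; rewrite -psiM.
have -> : 2^-1 * (1 + z) * (1 - 2^-1 * (1 + z)) = (1 - z ^+ 2) * (2^-1)^+2.
  by field.
by rewrite psiM psiX -phiE phiV phi2 mulr1.
Qed.

(** As [psi ^ 3 t = psi t^-1], the summand is [psi (t^-1 - 1)], and [t^-1 - 1]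
    runs over everything but [-1]. *)
Lemma sum_psi3_psi_compl : \sum_t psi t ^+ 3 * psi (1 - t) = -1.
Proof.
rewrite (bigD1 0) //= psi0 expr0n mul0r add0r.
rewrite (eq_bigr (fun t => psi (t^-1 - 1))) => [|t t0]; last first.
  by rewrite -psiV -psiM mulrBr mulr1 mulVf.
rewrite (reindex_inj invr_inj) /=.
under eq_bigr do rewrite invrK.
under eq_bigl do rewrite invr_eq0.
have := sum_psi; rewrite (reindex_inj (addIr (-1))) /= (bigD1 0) //= add0r psiN1.
by move/eqP; rewrite addrC addr_eq0 => /eqP.
Qed.

Lemma sum_phi_psi_sqr : \sum_z (phi z)%:~R * psi (1 - z ^+ 2) = jacobi_pi - 1.
Proof.
rewrite (sum_phi_over_squares (fun z => psi (1 - z))).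
under eq_bigr do rewrite mulrDl.
by rewrite big_split /= sum_psi_psi_compl sum_psi3_psi_compl.
Qed.

(** The exponent 8 is halved twice, each step producing the sum for the smaller
    exponent and a sum twisted by [phi]. *)
Lemma sum_psi_octic :
  \sum_x psi (1 - x ^+ 8) =
  jacobi_pi *+ 2 - 1 + (sum_psi_cubic + sum_psi_quotient).
Proof.
under eq_bigr do rewrite (exprM _ 2 4).
rewrite (sum_over_squares (fun t => psi (1 - t ^+ 4))).
under eq_bigr do rewrite (exprM _ 2 2).
under [X in _ + X]eq_bigr do rewrite (exprM _ 2 2).
rewrite (sum_over_squares (fun t => psi (1 - t ^+ 2))).
rewrite (sum_phi_over_squares (fun t => psi (1 - t ^+ 2))).
congr (_ + _); last first.
  under eq_bigr do rewrite mulrDl.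
  rewrite big_split /=; congr (_ + _).
  by apply: eq_bigr => z _; rewrite psiM.
by rewrite sum_phi_psi_sqr addrA.
Qed.

(** * Jacobsthal sums and the quadratic character sum over 1 - x^8 *)

(** After a translation the product is [phi (n (n + c))], which for [n] nonzero
    equals [phi (1 + c / n)]; here [1 + c / n] runs over everything but 1. *)
Lemma sum_phi_shift_mul (a b : F) : a != b ->
  \sum_n phi (n + a) * phi (n + b) = -1.
Proof.
move=> ab; have c0 : b - a != 0 by rewrite subr_eq0 eq_sym.
rewrite (reindex_inj (addIr (- a))) /=.
under eq_bigr do rewrite subrK -addrA [- a + b]addrC.
rewrite (bigD1 0) //= phi0 mul0r add0r.
rewrite (eq_bigr (fun n => phi (1 + (b - a) * n^-1))) => [|n n0]; last first.
  by rewrite -{1}[n in phi n]invrK phiV -phiM mulrDr mulVf // [n^-1 * _]mulrC.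
rewrite (reindex_inj invr_inj) /=.
under eq_bigr do rewrite invrK.
under eq_bigl do rewrite invr_eq0.
have := sum_phi; rewrite (reindex_inj (addrI 1)) /= (reindex_inj (mulfI c0)) /=.
rewrite (bigD1 0) //= mulr0 addr0 phi1.
by move/eqP; rewrite addrC addr_eq0 => /eqP.
Qed.

Lemma sum_phi_shift_sqr (a : F) : \sum_n phi (n + a) * phi (n + a) = (8 * f)%N%:Z.
Proof.
rewrite (reindex_inj (addIr (- a))) /=.
under eq_bigr do rewrite subrK.
rewrite (bigD1 0) //= phi0 mul0r add0r.
rewrite (eq_bigr (fun=> 1)) => [|n n0]; last by rewrite -expr2 phi_sq.
by rewrite sumr_const cardC1 cardF natz.
Qed.

Definition jacobsthal (m : nat) (n : F) : int := \sum_x phi x * phi (x ^+ m + n).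

Lemma phi_expr_even m x : ~~ odd m -> x != 0 -> phi (x ^+ m) = 1.
Proof.
move=> em x0; rewrite phiX -(odd_double_half m) (negPf em) add0n -mul2n exprM.
by rewrite phi_sq // expr1n.
Qed.

Lemma jacobsthal_scale m c n : ~~ odd m -> c != 0 ->
  jacobsthal m (c ^+ m * n) = phi c * jacobsthal m n.
Proof.
move=> em c0; rewrite /jacobsthal (reindex_inj (mulfI c0)) mulr_sumr /=.
apply: eq_bigr => x _; rewrite exprMn -mulrDr !phiM phi_expr_even //.
by rewrite mul1r mulrA.
Qed.

Lemma jacobsthal_inv m n : ~~ odd m -> n != 0 ->
  jacobsthal m n = phi n * jacobsthal m n^-1.
Proof.
move=> em n0; rewrite /jacobsthal (reindex_inj invr_inj) mulr_sumr /=.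
apply: eq_bigr => x _; rewrite phiV.
have [->|x0] := eqVneq x 0; first by rewrite phi0 !mul0r mulr0.
rewrite mulrCA; congr (_ * _).
rewrite -phiM -[LHS]mul1r -(phi_expr_even em x0) -phiM; congr phi.
by rewrite exprVn !mulrDr !divff ?expf_neq0 // mulrC addrC.
Qed.

Lemma jacobsthal2N1 : jacobsthal 2 (-1) = jacobsthal 2 1.
Proof.
rewrite -zeta4_sq -[_ ^+ 2]mulr1 jacobsthal_scale ?zeta4_neq0 //.
by rewrite phi_zeta4 mul1r.
Qed.

(** The same halving of the exponent as for [psi]. The twisted sums are
    Jacobsthal sums at [-1], which reduce to those at 1 because
    [-1 = zeta4 ^ 2 = zeta8 ^ 4], the second with a sign [phi zeta8 = -1]. *)
Lemma sum_phi_octic :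
  \sum_x phi (1 - x ^+ 8) = -1 + jacobsthal 2 1 - jacobsthal 4 1.
Proof.
under eq_bigr do rewrite (exprM _ 2 4).
rewrite (sum_over_squares_int (fun t => phi (1 - t ^+ 4))).
under eq_bigr do rewrite (exprM _ 2 2).
rewrite (sum_over_squares_int (fun t => phi (1 - t ^+ 2))).
rewrite (sum_over_squares_int (fun t => phi (1 - t))).
have z4 := zeta4_sq.
have QN4 : jacobsthal 4 (-1) = - jacobsthal 4 1.
  rewrite -z4 -zeta8_sq -exprM -[_ ^+ _]mulr1 jacobsthal_scale ?zeta8_neq0 //.
  by rewrite phi_zeta8 mulN1r.
congr (_ + _ + _); last 1 first.
- by rewrite -QN4; apply: eq_bigr => x _; rewrite -[phi (1 - _)]phiN opprB.
- rewrite -(@sum_phi_shift_mul 0 (-1)) ?(eq_sym 0) ?oppr_eq0 ?oner_eq0 //.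
  have s0 := sum_phi; rewrite (reindex_inj (subrI 1)) in s0.
  rewrite s0 add0r; apply: eq_bigr => x _.
  by rewrite addr0 -[phi (1 - _)]phiN opprB.
rewrite -jacobsthal2N1; apply: eq_bigr => x _.
by rewrite -[phi (1 - _)]phiN opprB.
Qed.

(** * Evaluation of the cubic and the quotient sum *)

(** The sum is grouped by [z - z^-1 = 2 w], which is the quadratic equation
    [(z - w)^2 = w^2 + 1]. *)
Lemma sum_sub_inv (h : F -> algC) :
  \sum_(z | z != 0) h z * psi (z - z^-1) =
  \sum_w psi (2 * w) * \sum_(z | z ^+ 2 == w ^+ 2 + 1) h (w + z).
Proof.
have h2 := two_neq0.
rewrite (partition_big (fun z : F => (z - z^-1) / 2) predT) //=.
apply: eq_bigr => w _; rewrite [in RHS](reindex_inj (addrI (- w))) mulr_sumr /=.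
apply: eq_big => [z|z /andP[_ /eqP <-]]; last first.
  by rewrite addrA addrN add0r [2 * _]mulrC divfK // mulrC.
have [->|z0] /= := eqVneq z 0.
  by rewrite addr0 sqrrN eq_sym -subr_eq0 addrAC subrr add0r oner_eq0.
rewrite -[LHS](inj_eq (mulfI (mulf_neq0 h2 z0))) -[RHS]subr_eq0.
by rewrite -[LHS]subr_eq0; congr (_ == 0); field; rewrite z0 h2.
Qed.

(** The point is the identity
    [2 (w + s) (w + i) = (w + i + s)^2] for [s^2 = w^2 + 1] and [i^2 = -1]: it
    makes the quadratic character of a root [w + s] of [z^2 - 2 w z - 1]
    rational in [w]. *)
Lemma sum_phi_sub_roots (w : F) :
  \sum_(z | z ^+ 2 == w ^+ 2 + 1) phi (w + z) = phi (w + zeta4) + phi (w - zeta4).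
Proof.
have z4 := zeta4_sq.
have wE : w ^+ 2 + 1 = (w + zeta4) * (w - zeta4) by ring: z4.
have [e0|w0] := eqVneq (w ^+ 2 + 1) 0.
  rewrite e0 sum_sqr_fiber0 addr0.
  move/eqP: e0; rewrite wE mulf_eq0 addr_eq0 subr_eq0 => /orP[]/eqP->.
    by rewrite phiN phi_zeta4 addNr phi0 add0r -opprD phiN -mulr2n -mulr_natl phiM
      phi2 phi_zeta4.
  by rewrite subrr phi0 addr0 -mulr2n -mulr_natl phiM phi2 phi_zeta4.
have [/phi_sqr[r r0 rE]|pw] := phi_sign w0; last first.
  rewrite sum_sqr_fiber_nonsquare //.
  move: w0 pw; rewrite wE phiM mulf_eq0 negb_or.
  by move=> /andP[/phi_sign[]-> /phi_sign[]->].
have key s : s ^+ 2 = w ^+ 2 + 1 -> phi (w + s) = phi (w + zeta4).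
  move=> sE.
  have h1 : w + zeta4 != 0 by apply: contraNneq w0 => e; rewrite wE e mul0r.
  have h2 : w + s != 0.
    apply/eqP => e; have /eqP : (w + s) * (w - s) = -1 by ring: sE.
    by rewrite e mul0r eq_sym oppr_eq0 oner_eq0.
  have E : (w + s) * 2 * (w + zeta4) = (w + zeta4 + s) ^+ 2 by ring: sE z4.
  have n0 : w + zeta4 + s != 0.
    have : (w + s) * 2 * (w + zeta4) != 0 by rewrite !mulf_neq0 ?two_neq0.
    by rewrite E expf_eq0.
  have : phi (w + s) * phi (w + zeta4) = phi (w + zeta4) * phi (w + zeta4).
    rewrite -[RHS]expr2 phi_sq // -[phi (w + s)]mulr1 -{1}phi2 -!phiM E.
    by rewrite phiX phi_sq.
  by move/mulIf; apply; case: (phi_sign h1) => ->.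
rewrite rE sum_sqr_fiber // key // key ?sqrrN //; congr (_ + _).
have p1 : phi (w + zeta4) * phi (w - zeta4) = 1.
  by rewrite -phiM -wE rE phiX phi_sq.
have h1 : w + zeta4 != 0 by apply: contraNneq w0 => e; rewrite wE e mul0r.
case: (phi_sign h1) p1 => ->; first by rewrite mul1r.
by rewrite mulN1r => <-; rewrite opprK.
Qed.

Lemma sum_psi_phi_shift (c : F) : c != 0 ->
  \sum_w psi w * (phi (w + c))%:~R = psi c * (phi c)%:~R * jacobi_pi.
Proof.
move=> c0; rewrite -sum_phi_psi_compl mulr_sumr.
rewrite (reindex_inj (mulfI (x := - c) _)) ?oppr_eq0 //=.
rewrite (reindex_inj (subrI 1)) /=; apply: eq_bigr => t _.
have -> : - c * (1 - t) + c = c * t by ring.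
by rewrite phiM rmorphM !psiM psiN /=; ring.
Qed.

(** Writing [z (1 - z^2) = - z^2 (z - z^-1)], the involution [z -> - z^-1] acts
    on the summand and descends the sum to the line with coordinate [w]. There
    it becomes two Jacobi sums, branched at [zeta4] and [- zeta4], each equal to
    [psi zeta4 * jacobi_pi = - jacobi_pi]. *)
Lemma sum_psi_cubicE : sum_psi_cubic = - (psi 2 * jacobi_pi) *+ 2.
Proof.
rewrite /sum_psi_cubic (bigD1 0) //= mul0r psi0 add0r.
rewrite (eq_bigr (fun z => (phi z)%:~R * psi (z - z^-1))); last first.
  by move=> z z0; rewrite phiE -psiX -psiM -psiN; congr psi; field.
rewrite sum_sub_inv.
under eq_bigr => w _ do
  rewrite -rmorph_sum /= sum_phi_sub_roots psiM rmorphD -mulrA mulrDr.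
rewrite -mulr_sumr big_split /= !sum_psi_phi_shift ?oppr_eq0 ?zeta4_neq0 //.
by rewrite psiN phiN psi_zeta4 phi_zeta4; ring.
Qed.

(** The summand is [psi (z - z^-1)], so the same descent gives the sum of
    [psi w * phi (w^2 + 1)]. It is invariant under [w -> w^-1], hence equal to
    its conjugate, and the sum of both is a Jacobsthal sum. *)
Lemma sum_psi_quotientE : sum_psi_quotient *+ 2 = psi 2 * (jacobsthal 4 1)%:~R.
Proof.
have -> : sum_psi_quotient = psi 2 * \sum_w psi w * (phi (w ^+ 2 + 1))%:~R.
  rewrite /sum_psi_quotient (bigD1 0) //= psi0 expr0n mul0r add0r.
  rewrite (eq_bigr (fun z => 1 * psi (z - z^-1))); last first.
    by move=> z z0; rewrite mul1r -psiV -psiM -psiN; congr psi; field.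
  rewrite (sum_sub_inv (fun=> 1)).
  rewrite (eq_bigr (fun w => psi 2 * (psi w + psi w * (phi (w ^+ 2 + 1))%:~R))).
    by rewrite -mulr_sumr big_split /= sum_psi add0r.
  by move=> w _; rewrite sum1_sqr_fiber psiM -mulrA mulrDr mulr1.
set C := \sum_w _; rewrite -mulrnAr; congr (_ * _).
rewrite /jacobsthal; rewrite rmorph_sum /=.
under eq_bigr => x _ do rewrite (exprM _ 2 2) rmorphM /=.
rewrite (sum_phi_over_squares (fun t => (phi (t ^+ 2 + 1))%:~R)).
under eq_bigr do rewrite mulrDl.
rewrite big_split /= mulr2n; congr (_ + _).
rewrite /C (reindex_inj invr_inj); apply: eq_bigr => w _ /=.
rewrite psiV; have [->|w0] := eqVneq w 0; first by rewrite psi0 expr0n !mul0r.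
congr (_ * _%:~R); rewrite -[LHS]mul1r -(phi_expr_even (m := 2) _ w0) // -phiM.
by rewrite exprVn mulrDr mulr1 divff ?expf_neq0 // addrC.
Qed.

(** * Jacobsthal sums: mean squares and congruences *)

(** A root of unity of order dividing [m] is the square of one of order dividing
    [2 m]. *)
Lemma phi_unity_root m w : (2 * m %| 8 * f)%N -> w ^+ m = 1 -> phi w = 1.
Proof.
move=> d2m wm; have m0 : (0 < m)%N.
  by case: m d2m {wm} => //; rewrite muln0 dvd0n muln_eq0 /= eqn0Ngt f_gt0.
have w0 : w != 0.
  by apply: contra_eq_neq wm => ->; rewrite expr0n eqn0Ngt m0 eq_sym oner_eq0.
have /eqP := wm; rewrite -(dlogK w0) -exprM -(prim_order_dvd gP) => d.
have := dvdn_trans d2m d; rewrite dvdn_pmul2r // phiX phig => d2.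
by rewrite -signr_odd -[odd _]negbK -dvdn2 d2.
Qed.

Lemma sum_expr_fiber m y (h : F -> int) a : (2 * m %| 8 * f)%N -> y != 0 ->
  (forall x, x ^+ m = y ^+ m -> h x = a) ->
  \sum_(x | x ^+ m == y ^+ m) h x = a *+ m.
Proof.
move=> d2m y0 hE; rewrite (eq_bigr (fun=> a)) => [|x /eqP/hE //].
rewrite sumr_const; congr (_ *+ _).
have dm := dvdn_trans (dvdn_mull 2 (dvdnn m)) d2m.
rewrite -[RHS](card_expr_fiber (dvdn_prim_root gP dm) y0).
by apply: eq_card => x; rewrite inE.
Qed.

Lemma phi_eq_expr m x y : (2 * m %| 8 * f)%N -> y != 0 ->
  x ^+ m = y ^+ m -> phi x = phi y.
Proof.
move=> d2m y0 e; have /(phi_unity_root d2m) : (x / y) ^+ m = 1.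
  by rewrite expr_div_n e divff ?expf_neq0.
rewrite phiM phiV => p; rewrite -[LHS]mulr1 -(phi_sq y0) expr2 mulrA p.
by rewrite mul1r.
Qed.

(** Orthogonality: summing over [n] first, the pair [(x, y)] contributes
    [#|F| - 1] if [x^m = y^m] and [-1] otherwise. The [-1]s cancel, and [x]
    has [m] partners [y], all with [phi y = phi x]. *)
Lemma sum_jacobsthal_sqr m : (0 < m)%N -> (2 * m %| 8 * f)%N ->
  \sum_n jacobsthal m n ^+ 2 = (m * (8 * f) * (8 * f).+1)%N%:Z.
Proof.
move=> m0 d2m.
transitivity (\sum_x \sum_y phi x * phi y *
   (((x ^+ m == y ^+ m)%:Z * (8 * f).+1%:Z) - 1)).
  under eq_bigr => n _ do rewrite expr2 /jacobsthal big_distrlr /=.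
  rewrite exchange_big /=; apply: eq_bigr => x _.
  rewrite exchange_big /=; apply: eq_bigr => y _.
  rewrite (eq_bigr (fun n => phi x * phi y *
    (phi (n + x ^+ m) * phi (n + y ^+ m)))).
    rewrite -mulr_sumr; congr (_ * _); have [->|/sum_phi_shift_mul->] := eqVneq.
      by rewrite sum_phi_shift_sqr mul1r; lia.
    by rewrite mul0r sub0r.
  by move=> n _; rewrite mulrACA ![n + _]addrC.
under eq_bigr => x _.
  under eq_bigr do rewrite mulrBr mulr1 -mulrA.
  rewrite sumrB -!mulr_sumr sum_phi mulr0 subr0.
  rewrite (_ : _ * _ = (x != 0)%:Z * (m * (8 * f).+1)%N%:Z); last first.
    have [->|x0] := eqVneq x 0; first by rewrite phi0 !mul0r.
    under eq_bigr do rewrite mulrCA.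
    rewrite (bigID (fun y => y ^+ m == x ^+ m)) /=.
    rewrite [X in _ + X]big1 ?addr0; last first.
      by move=> y /negPf; rewrite eq_sym => ->; rewrite mul0r.
    rewrite (sum_expr_fiber (y := x) (a := phi x * (8 * f).+1%:Z)) //.
      by rewrite mul1r mulrnAr mulrA -expr2 phi_sq // mul1r -mulr_natr natz; lia.
    by move=> y e; rewrite e eqxx mul1r (phi_eq_expr d2m x0 e).
  over.
rewrite -mulr_suml (bigD1 0) //= eqxx add0r (eq_bigr (fun=> 1)) => [|x -> //].
by rewrite sumr_const cardC1 cardF natz /=; lia.
Qed.

Lemma sum_nonzero_expg (R : nmodType) (h : F -> R) :
  \sum_(n | n != 0) h n = \sum_(0 <= j < 8 * f) h (g ^+ j).
Proof.
rewrite big_mkord.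
rewrite -(big_imset h (A := mem 'I_(8 * f)) (h := fun i => g ^+ nat_of_ord i)) /=.
  apply: eq_bigl => x; apply/idP/imsetP => [x0|[i _ ->]]; last first.
    by rewrite expf_neq0 ?g_neq0.
  have [|i xE] := @prim_rootP _ _ _ gP x; last by exists i.
  by apply: (mulfI x0); rewrite -exprS -cardF expf_card mulr1.
move=> i j _ _ /eqP; rewrite (eq_prim_root_expr gP) !modn_small //.
by move/eqP/val_inj.
Qed.

Lemma sum_coset_classes (R : nmodType) m (h : F -> R) : (m %| 8 * f)%N ->
  (forall n, h (g ^+ m * n) = h n) ->
  \sum_(n | n != 0) h n = (\sum_(0 <= k < m) h (g ^+ k)) *+ (8 * f %/ m).
Proof.
move=> dm hm; rewrite sum_nonzero_expg -{1}(divnK dm) big_nat_mul.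
rewrite (eq_big_nat _ _ (F2 := fun=> \sum_(0 <= k < m) h (g ^+ k))).
  by rewrite sumr_const_nat subn0.
move=> i _; rewrite -{1}[(i * m)%N]add0n big_addn mulSn addnK.
apply: eq_bigr => k _; elim: i => [|i IHi]; first by rewrite mul0n addn0.
by rewrite mulSn addnCA exprD hm.
Qed.

Lemma jacobsthal0 m : ~~ odd m -> jacobsthal m 0 = 0.
Proof.
move=> em; rewrite /jacobsthal -[RHS]sum_phi.
apply: eq_bigr => x _; rewrite addr0.
have [->|x0] := eqVneq x 0; first by rewrite phi0 mul0r.
by rewrite phi_expr_even // mulr1.
Qed.

(** [jacobsthal m] depends up to sign only on the class of its argument modulo
    [m]-th powers, so the mean square is an average over [m] classes. *)
Lemma sum_jacobsthal_sqr_classes m :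
  (0 < m)%N -> ~~ odd m -> (2 * m %| 8 * f)%N ->
  \sum_(0 <= k < m) jacobsthal m (g ^+ k) ^+ 2 = (m ^ 2 * (8 * f).+1)%N%:Z.
Proof.
move=> m0 em d2m; have dm := dvdn_trans (dvdn_mull 2 (dvdnn m)) d2m.
have := sum_jacobsthal_sqr m0 d2m.
rewrite (bigD1 0) //= jacobsthal0 // expr0n add0r.
rewrite (sum_coset_classes dm) => [|n]; last first.
  by rewrite jacobsthal_scale ?g_neq0 // exprMn phi_sq ?g_neq0 // mul1r.
have q0 : (0 < 8 * f %/ m)%N by rewrite divn_gt0 // dvdn_leq // muln_gt0.
rewrite -mulr_natr => e; apply: (@mulIf _ (8 * f %/ m)%N%:R).
  by rewrite pnatr_eq0 -lt0n.
rewrite e natz -PoszM -[in LHS](divnK dm); congr Posz.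
set c := (8 * f %/ m)%N; lia.
Qed.

(** Scaling combined with [n -> n^-1] kills the class of [g ^ 2] and identifies
    those of [g] and [g ^ 3]; what remains of the four squares is the form
    [u^2 + 2 v^2]. *)
Lemma jacobsthal4_norm :
  jacobsthal 4 1 ^+ 2 + 2 * jacobsthal 4 g ^+ 2 = 16 * (8 * f).+1%:Z.
Proof.
have d : (2 * 4 %| 8 * f)%N by rewrite dvdn_mulr.
have g0 := g_neq0.
have := sum_jacobsthal_sqr_classes (m := 4) isT isT d.
rewrite !big_nat_recr // big_nil /= expr0 expr1.
have -> : jacobsthal 4 (g ^+ 2) = 0.
  have e1 := @jacobsthal_inv 4 (g ^+ 2) isT (expf_neq0 2 g0).
  have e2 := @jacobsthal_scale 4 g (g ^+ 2)^-1 isT g0.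
  rewrite (_ : g ^+ 4 * _ = g ^+ 2) in e2; last by field; rewrite g0.
  move: e1; rewrite phiX phig sqrrN expr1n mul1r => e1.
  by move: e2; rewrite -e1 phig; lia.
have -> : jacobsthal 4 (g ^+ 3) = jacobsthal 4 g.
  have e1 := @jacobsthal_inv 4 (g ^+ 3) isT (expf_neq0 3 g0).
  have e2 := @jacobsthal_scale 4 g (g ^+ 3)^-1 isT g0.
  rewrite (_ : g ^+ 4 * _ = g) in e2; last by field; rewrite g0.
  by rewrite e1 e2 phiX phig; ring.
rewrite expr0n addr0 add0r => e.
by apply: etrans (etrans _ e) _; [ring|lia].
Qed.

Lemma jacobsthal2_norm :
  jacobsthal 2 1 ^+ 2 + jacobsthal 2 g ^+ 2 = 4 * (8 * f).+1%:Z.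
Proof.
have d : (2 * 2 %| 8 * f)%N by rewrite -(mulnA 4 2 f) dvdn_mulr.
have := sum_jacobsthal_sqr_classes (m := 2) isT isT d.
by rewrite !big_nat_recr // big_nil /= expr0 expr1 add0r => ->.
Qed.

Lemma expf_neq0_pos (x : F) m : (0 < m)%N -> (x ^+ m != 0) = (x != 0).
Proof. by move=> m0; rewrite expf_eq0 m0. Qed.

(** The summand [G x] takes the same value at the [m]-th roots of unity times
    [x] and times [x^-1]. These are [2 m] points unless [x^(2m) = 1], and they
    are exactly a fibre of [x^m + x^-m]. The points with [x^m = 1] contribute 1
    each and those with [x^m = -1] contribute 0. All other fibres contribute
    [2 m] or [- 2 m], so replacing their signs by 1 changes the sum by a multiple
    of [4 m]. *)
Lemma jacobsthal_mod m : (0 < m)%N -> ~~ odd m -> (2 * m %| 8 * f)%N ->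
  exists k : int, jacobsthal m 1 = (8 * f)%N%:Z - m%:Z + (4 * m)%N%:Z * k.
Proof.
move=> m0 em d2m.
pose G (x : F) := phi x * phi (x ^+ m + 1).
have inv (x : F) : x != 0 -> G x^-1 = G x.
  move=> x0; rewrite /G phiV -[phi (x ^+ m + 1)]mul1r; congr (_ * _).
  rewrite -[LHS]mul1r -(phi_expr_even em x0) -phiM.
  by rewrite exprVn mulrDr mulr1 divff ?expf_neq0 // addrC phi_expr_even ?mul1r.
have cst (x y : F) : y != 0 -> x ^+ m = y ^+ m -> G x = G y.
  by move=> y0 e; rewrite /G (phi_eq_expr d2m y0 e) e.
pose A (x : F) := (x != 0) && (x ^+ (2 * m) != 1).
pose h (x : F) := x ^+ m + x ^- m.
have fib (y : F) : y != 0 -> y ^+ (2 * m) != 1 ->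
   \sum_(x | A x && (h x == h y)) (1 - G x) = (1 - G y) *+ (2 * m).
  move=> y0 y1.
  have yn : y ^+ m != y ^- m.
    apply: contra y1 => /eqP e; rewrite mulnC exprM expr2 {2}e divff //.
    by rewrite expf_neq0.
  have Y0 : y ^+ m != 0 by rewrite expf_neq0.
  (* X + 1/X = Y + 1/Y means X = Y or X = 1/Y, for X = x^m and Y = y^m. *)
  have AE (x : F) :
      A x && (h x == h y) = (x ^+ m == y ^+ m) || (x ^+ m == y^-1 ^+ m).
    rewrite /A /h -(expf_neq0_pos x m0) mulnC exprM exprVn.
    rewrite mulnC exprM in y1.
    have [->|X0] := eqVneq (x ^+ m) 0.
      by rewrite !(eq_sym 0) (negPf Y0) invr_eq0 (negPf Y0).
    move: (x ^+ m) (y ^+ m) X0 Y0 y1 => X Y X0 Y0 Y1 /=.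
    have -> : (X + X^-1 == Y + Y^-1) = (X == Y) || (X == Y^-1).
      rewrite -subr_eq0 -[X == Y]subr_eq0 -[X == Y^-1]subr_eq0 -mulf_eq0.
      rewrite -[RHS](mulrI_eq0 _ (mulfI (invr_neq0 X0))); congr (_ == 0).
      by field; rewrite X0 Y0.
    case: (eqVneq X Y) => [->|_]; first by rewrite Y1.
    by case: (eqVneq X Y^-1) => [->|_]; rewrite ?andbF // exprVn invr_eq1 Y1.
  rewrite (eq_bigl _ _ AE) (bigID (fun x => x ^+ m == y ^+ m)) /=.
  rewrite mul2n -addnn mulrnDr; congr (_ + _).
    rewrite -(sum_expr_fiber (h := fun x => 1 - G x) d2m y0); last first.
      by move=> x e; rewrite (cst x y).
    by apply: eq_bigl => x; case: eqP; rewrite ?andbF.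
  have yi0 : y^-1 != 0 by rewrite invr_eq0.
  rewrite -(sum_expr_fiber (h := fun x => 1 - G x) d2m yi0); last first.
    by move=> x e; rewrite (cst x y^-1) // inv.
  apply: eq_bigl => x; case: (eqVneq (x ^+ m) (y ^+ m)) => [->|_];
    rewrite ?andbF ?andbT //.
  by rewrite exprVn (negPf yn).
have dvdA : ((4 * m)%N%:Z %| \sum_(x | A x) (1 - G x))%Z.
  rewrite (partition_big h predT) //=; apply: rpred_sum => v _.
  case: (pickP (fun x => A x && (h x == v))) => [y /andP[/andP[y0 y1] /eqP <-]|e].
    rewrite fib //.
    have n1 : y ^+ m + 1 != 0.
      apply: contra y1; rewrite addr_eq0 mulnC exprM => /eqP->.
      by rewrite sqrrN expr1n.
    apply/dvdzP; rewrite /G.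
    case: (phi_sign y0) => ->; case: (phi_sign n1) => ->;
      [exists 0|exists 1|exists 1|exists 0];
      rewrite -mulr_natl natz; lia.
  by rewrite big_pred0 // rpred0.
have SA : \sum_(x | x != 0) (1 - G x) = m%:Z + \sum_(x | A x) (1 - G x).
  rewrite (bigID (fun x => x ^+ (2 * m) == 1)) /=; congr (_ + _).
  rewrite (bigID (fun x => x ^+ m == 1)) /= big1 ?add0r => [|x]; last first.
    move=> /andP[_ /eqP x1].
    by rewrite /G x1 phi2 (phi_unity_root d2m x1) subrr.
  (* The roots of x^m = -1 form the fibre of the power map through z. *)
  pose z := g ^+ (8 * f %/ (2 * m)).
  have z0 : z != 0 by rewrite expf_neq0 ?g_neq0.
  have zm : z ^+ m = -1.
    rewrite -zeta4_sq -!exprM; congr (_ ^+ _).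
    apply/eqP; rewrite -(eqn_pmul2l (isT : 0 < 2)%N) mulnCA divnK //.
    by apply/eqP; lia.
  transitivity ((1 : int) *+ m); last by rewrite natz.
  rewrite -(sum_expr_fiber (h := fun x => 1 - G x) d2m z0); last first.
    by move=> x e; rewrite /G e zm addNr phi0 mulr0 subr0.
  apply: eq_bigl => x; rewrite zm mulnC exprM sqrf_eq1.
  case: (eqVneq (x ^+ m) (-1)) => [e|ne]; last first.
    by rewrite orbF; case: (x ^+ m == 1); rewrite ?andbF.
  rewrite e orbT /= andbT -(expf_neq0_pos x m0) e oppr_eq0 oner_eq0 /=.
  apply: contraTneq two_neq0 => e1; rewrite negbK.
  by rewrite mulr2n -{1}e1 addNr.
have S0 : \sum_(x | x != 0) (1 - G x) = (8 * f)%N%:Z - jacobsthal m 1.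
  rewrite sumrB sumr_const cardC1 cardF natz /jacobsthal; congr (_ - _).
  by rewrite [RHS](bigD1 0) //= phi0 mul0r add0r.
have /dvdzP[k kE] := dvdA; exists (- k).
by move: S0; rewrite SA kE; lia.
Qed.

(** The congruence fixes the sign of [u]; it rests on [f] being odd. *)
Lemma jacobsthal4_norm_form : exists u v : int,
  [/\ jacobsthal 4 1 = 4 * u, (exists k, u = 4 * k + 1)
    & (8 * f).+1%:Z = u ^+ 2 + 2 * v ^+ 2].
Proof.
have [|k kE] := @jacobsthal_mod 4 isT isT _; first by rewrite dvdn_mulr.
have fE : f%:Z = 2 * (f./2)%:Z + 1 by rewrite [in LHS]f_half; lia.
have [u [uE uk]] : exists u, jacobsthal 4 1 = 4 * u /\ exists k, u = 4 * k + 1.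
  by exists (2 * f%:Z - 1 + 4 * k); split; [lia | exists ((f./2)%:Z + k); lia].
have := jacobsthal4_norm; rewrite uE.
move: (jacobsthal 4 g) (8 * f).+1%:Z => w q wE.
have [|w1 w1E] := @even_of_sqr w (4 * (q - u ^+ 2)); first by lia.
have w1q : w1 ^+ 2 = 2 * (q - u ^+ 2) by move: wE; rewrite w1E !exprMn; lia.
have [v vE] := even_of_sqr w1q.
exists u, v; split=> //; move: w1q; rewrite vE exprMn; lia.
Qed.

Lemma jacobsthal2_norm_form : exists X Y : int,
  [/\ jacobsthal 2 1 = 2 * X, (exists k, X = 4 * k + 3)
    & (8 * f).+1%:Z = X ^+ 2 + 4 * Y ^+ 2].
Proof.
have [|k kE] := @jacobsthal_mod 2 isT isT _.
  by rewrite -(mulnA 4 2) dvdn_mulr.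
have [X [XE [m XM]]] :
    exists X, jacobsthal 2 1 = 2 * X /\ exists m, X = 4 * m + 3.
  by exists (4 * f%:Z - 1 + 4 * k); split; [lia | exists (f%:Z + k - 1); lia].
have := jacobsthal2_norm; rewrite XE; move: (jacobsthal 2 g) => w wE.
have [|w1 w1E] := @even_of_sqr w (2 * ((8 * f).+1%:Z - X ^+ 2)).
  by lia.
have XX : X ^+ 2 = 16 * m ^+ 2 + 24 * m + 9 by rewrite XM; ring.
have w1q : w1 ^+ 2 = 2 * (4 * f%:Z - 8 * m ^+ 2 - 12 * m - 4).
  by move: wE; rewrite w1E !exprMn XX; lia.
have [v vE] := even_of_sqr w1q.
exists X, v; split; [by [] | by exists m |].
by move: w1q; rewrite vE exprMn XX; lia.
Qed.

(** * The quartic character of 2 *)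

Definition jacobi i j := \sum_t psi t ^+ i * psi (1 - t) ^+ j.

Lemma jacobi_sym i j : jacobi i j = jacobi j i.
Proof.
rewrite /jacobi (reindex_inj (subrI 1)) /=; apply: eq_bigr => t _.
by rewrite subKr mulrC.
Qed.

Lemma jacobi11 : jacobi 1 1 = jacobi_pi.
Proof. exact: sum_psi_psi_compl. Qed.

Lemma jacobi21 : jacobi 2 1 = jacobi_pi.
Proof. by rewrite -sum_phi_psi_compl; apply: eq_bigr => t _; rewrite phiE. Qed.

Lemma jacobi31 : jacobi 3 1 = -1.
Proof. exact: sum_psi3_psi_compl. Qed.

Lemma jacobi22 : jacobi 2 2 = -1.
Proof.
have n01 : 0 != -1 :> F by rewrite eq_sym oppr_eq0 oner_eq0.
have := congr1 (fun n : int => n%:~R : algC) (sum_phi_shift_mul n01).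
rewrite rmorphN rmorph_sum => <-; apply: eq_bigr => t _.
by rewrite -!phiE -rmorphM /= addr0 -[phi (1 - t)]phiN opprB.
Qed.

Lemma jacobi_conj i j : (jacobi i j)^* = jacobi (3 * i) (3 * j).
Proof.
rewrite rmorph_sum; apply: eq_bigr => t _.
by rewrite rmorphM !rmorphXn /= !psi_conj -!exprM.
Qed.

Lemma psi_exp6 x : psi x ^+ 6 = psi x ^+ 2.
Proof. by rewrite exprS psi_exp5. Qed.

Lemma jacobi33 : jacobi 3 3 = jacobi_pi^*.
Proof. by rewrite -jacobi11 jacobi_conj. Qed.
Lemma jacobi23 : jacobi 2 3 = jacobi_pi^*.
Proof.
by rewrite -jacobi21 jacobi_conj; apply: eq_bigr => t _; rewrite psi_exp6.
Qed.

Lemma jacobi_pi_real : jacobi_pi + jacobi_pi^* = (jacobsthal 2 1)%:~R.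
Proof.
rewrite -jacobsthal2N1 -jacobi23 (jacobi_sym 2 3) -jacobi21 (jacobi_sym 2 1).
rewrite /jacobsthal rmorph_sum /=.
under eq_bigr do rewrite -[phi (_ - 1)]phiN opprB rmorphM.
rewrite (sum_phi_over_squares (fun t => (phi (1 - t))%:~R)).
under eq_bigr do rewrite mulrDl.
by rewrite big_split; congr (_ + _); apply: eq_bigr => t _; rewrite phiE.
Qed.

Lemma sum_psi_exp j : (0 < j < 4)%N -> \sum_t psi t ^+ j = 0.
Proof.
case: j => [|[|[|[|j]]]] // _; first exact: sum_psi.
  under eq_bigr do rewrite -phiE.
  by rewrite -rmorph_sum sum_phi.
under eq_bigr do rewrite -psi_conj.
by rewrite -rmorph_sum sum_psi rmorph0.
Qed.

Lemma jacobi4 j : (0 < j < 4)%N -> jacobi 4 j = -1.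
Proof.
move=> hj; rewrite jacobi_sym /jacobi (bigD1 1) //=.
rewrite subrr psi0 expr0n mulr0 add0r.
rewrite (eq_bigr (fun t => psi t ^+ j)) => [|t t1]; last first.
  by rewrite psi4 ?mulr1 // subr_eq0 eq_sym.
have /eqP := sum_psi_exp hj.
by rewrite (bigD1 1) //= psi1 expr1n addrC addr_eq0 => /eqP.
Qed.

Lemma jacobi44 : jacobi 4 4 = (8 * f)%:R - 1.
Proof.
rewrite /jacobi (bigD1 0) //= psi0 expr0n mul0r add0r.
rewrite (bigD1 1) ?oner_eq0 //= subrr psi0 expr0n mulr0 add0r.
rewrite (eq_bigr (fun=> 1)) => [|t /andP[t0 t1]]; last first.
  by rewrite !psi4 ?mulr1 // subr_eq0 eq_sym.
rewrite sumr_const -[X in X - 1](_ : (#|predC1 (0 : F)|)%:R = _); last first.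
  by rewrite cardC1 cardF.
rewrite (cardD1 1 (predC1 0)) !inE oner_eq0 /= natrD addrAC subrr add0r.
by congr _%:R; apply: eq_card => t; rewrite !inE andbC.
Qed.

(** Orthogonality of the powers of [psi]; [psi ^ 4] is used as the trivial
    character so that the value at 0 is right. *)
Lemma psi_indicator x : \sum_(1 <= j < 5) psi x ^+ j = 4 *+ (psi x == 1).
Proof.
rewrite big_1_5.
have [->|x0] := eqVneq x 0.
  by rewrite psi0 !expr0n /= !addr0 eq_sym oner_eq0.
case: (eqVneq (psi x) 1) => [->|p1]; first by rewrite !expr1n mulr1n; ring.
have h := psi_exp5 x.
apply/eqP; rewrite -(inj_eq (mulfI (x := psi x - 1) _)) ?subr_eq0 //.
rewrite mulr0n mulr0.
by apply/eqP; ring: h.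
Qed.

(** These [t = x^4] with [1 - t = y^4] are the affine points, up to fourth roots
    of unity, of the Fermat quartic [x^4 + y^4 = 1] off the axes. *)
Definition fermat_set : {set F} := [set t | (psi t == 1) && (psi (1 - t) == 1)].

(** The sum of the sixteen Jacobi sums of powers of [psi]. *)
Lemma card_fermat_set :
  16 * #|fermat_set|%:Z = (8 * f)%N%:Z - 10 + 3 * jacobsthal 2 1.
Proof.
apply/intC_inj.
transitivity (\sum_(1 <= i < 5) \sum_(1 <= j < 5) jacobi i j).
  transitivity (\sum_t (\sum_(1 <= i < 5) psi t ^+ i) *
                       (\sum_(1 <= j < 5) psi (1 - t) ^+ j)).
    rewrite rmorphM /= -pmulrn -sum1_card natr_sum mulr_sumr big_mkcond /=.
    apply: eq_bigr => t _; rewrite !psi_indicator inE.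
    by case: eqP; case: eqP => _ _ /=; ring.
  under eq_bigr do rewrite big_distrlr /=.
  rewrite exchange_big; apply: eq_bigr => i _.
  by rewrite exchange_big.
rewrite !big_1_5.
rewrite (jacobi_sym 1 2) (jacobi_sym 1 3) (jacobi_sym 1 4).
rewrite (jacobi_sym 3 2) (jacobi_sym 2 4) (jacobi_sym 3 4).
rewrite jacobi44 jacobi11 jacobi21 jacobi22 jacobi31 jacobi23 jacobi33.
rewrite !jacobi4 //.
rewrite intrD intrM intrB -pmulrn -jacobi_pi_real; move: (8 * f)%N => K; ring.
Qed.

(** The involution [t -> 1 - t] acts on the set and its only possible fixed point
    is [1 / 2], which lies in the set exactly if [psi 2 = 1]. With
    [t = (1 + y) / 2] it becomes [y -> - y]. *)
Lemma card_fermat_set_even : psi 2 != 1 -> ~~ odd #|fermat_set|.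
Proof.
move=> p2.
pose c y : nat := (psi ((1 + y) / 2) == 1) && (psi ((1 - y) / 2) == 1).
have h2 := two_neq0.
have -> : #|fermat_set| = (\sum_y c y)%N.
  rewrite -sum1_card big_mkcond /= (reindex_inj (mulIf (invr_neq0 h2))) /=.
  rewrite (reindex_inj (addrI 1)) /=; apply: eq_bigr => y _; rewrite inE /c.
  rewrite (_ : 1 - (1 + y) / 2 = (1 - y) / 2); last by field.
  by case: andP.
rewrite (partition_big (fun y : F => y ^+ 2) predT) //=.
rewrite -dvdn2; apply: dvdn_sum => x _.
have [->|x0] := eqVneq x 0.
  rewrite (sum_sqr_fiber0 c) /c addr0 mul1r (_ : _ == 1 = false) //.
  apply: contraNF p2 => /eqP e.
  by rewrite -[psi 2]mulr1 -{1}e -psiM divff // psi1.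
have [/phi_sqr[y y0 ->]|px] := phi_sign x0.
  rewrite (sum_sqr_fiber c) // (_ : c (- y) = c y); last first.
    by rewrite /c opprK andbC.
  by rewrite -[c y + c y]/(c y + c y)%N addnn -muln2 dvdn_mull.
by rewrite (sum_sqr_fiber_nonsquare c).
Qed.

Lemma psi2_eq1 : odd #|fermat_set| -> psi 2 = 1.
Proof. by move=> h; apply/eqP; apply: contraLR h => /card_fermat_set_even. Qed.

(** When [psi 2 = 1], the cubic sum is [- 2 jacobi_pi] and cancels the Jacobi
    sum. *)
Lemma sum_psi_octic_eval (u : int) : psi 2 = 1 -> jacobsthal 4 1 = 4 * u ->
  \sum_x psi (1 - x ^+ 8) = (2 * u - 1)%:~R.
Proof.
move=> p2 uE; have B2 : sum_psi_quotient = (2 * u)%:~R.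
  have := sum_psi_quotientE; rewrite p2 mul1r uE => h.
  apply: (@mulIf _ 2%:R); first by rewrite pnatr_eq0.
  by rewrite mulr_natr h !intrM; ring.
by rewrite sum_psi_octic sum_psi_cubicE p2 B2 intrB; ring.
Qed.

(** * Differences of octic residues *)

(** [octic_residues p] is the case of the prime field. *)
Definition octics : {set F} := [set x ^+ 8 | x : F & x \is a GRing.unit].

Lemma octicsP t : reflect (exists2 x, x != 0 & t = x ^+ 8) (t \in octics).
Proof.
apply: (iffP imsetP) => [[x]|[x x0 ->]]; first by rewrite inE unitfE; exists x.
by exists x; rewrite // inE unitfE.
Qed.

Lemma octics_neq0 t : t \in octics -> t != 0.
Proof. by case/octicsP => x x0 ->; rewrite expf_neq0. Qed.

Lemma octics_div s t : s \in octics -> t \in octics -> s / t \in octics.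
Proof.
case/octicsP => x x0 -> /octicsP[y y0 ->]; apply/octicsP; exists (x / y).
  by rewrite mulf_neq0 ?invr_eq0.
by rewrite expr_div_n.
Qed.

Lemma octics1 : 1 \in octics.
Proof. by apply/octicsP; exists 1; rewrite ?oner_eq0 ?expr1n. Qed.

Lemma octics_expg k : (g ^+ k \in octics) = (8 %| k)%N.
Proof.
apply/octicsP/idP => [[x x0]|/dvdnP[j ->]]; last first.
  by exists (g ^+ j); rewrite ?expf_neq0 ?g_neq0 // exprM.
rewrite -(dlogK x0) -exprM => /eqP; rewrite (eq_prim_root_expr gP) => /eqP e.
have d8 : (8 %| 8 * f)%N by rewrite dvdn_mulr.
by rewrite /dvdn -(modn_dvdm k d8) e modn_dvdm // -/(dvdn _ _) dvdn_mull.
Qed.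

Lemma octics_opp t : t \in octics -> - t \notin octics.
Proof.
move=> tD; apply/negP => /octics_div-/(_ _ tD).
rewrite mulNr divff ?octics_neq0 // -zeta4_sq -!exprM octics_expg.
by rewrite f_half; lia.
Qed.

(** As [-1 = g ^ (4 f)] with [f] odd, [-1] is a fourth power but not an eighth
    power, so the fourth powers are the octic residues and their negatives. *)
Lemma psi_octics t : t != 0 -> (psi t == 1) = (t \in octics) || (- t \in octics).
Proof.
move=> t0; apply/eqP/orP => [|h]; last first.
  have key s : s \in octics -> psi s = 1.
    by case/octicsP => x x0 ->; rewrite (exprM _ 2 4) psiX psi4 // expf_neq0.
  by case: h => /key //; rewrite psiN.
rewrite -(dlogK t0); move: (dlog t) => k; rewrite psi_expg => /eqP.
rewrite expi_eq1 => /dvdnP[j ->].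
rewrite -mulN1r -zeta4_sq -!exprM -exprD !octics_expg.
by rewrite f_half; lia.
Qed.

Lemma sum_octic (R : pzRingType) (h : F -> R) :
  \sum_x h (x ^+ 8) = h 0 + 8%:R * \sum_(d in octics) h d.
Proof.
rewrite (bigD1 0) //= expr0n; congr (_ + _).
rewrite (partition_big (fun x => x ^+ 8) (mem octics)) /=; last first.
  by move=> x x0; apply/octicsP; exists x.
rewrite mulr_sumr; apply: eq_bigr => d /octicsP[y y0 ->].
rewrite (eq_bigr (fun=> h (y ^+ 8))) => [|x /andP[_ /eqP->] //].
rewrite sumr_const mulr_natl; congr (_ *+ _).
rewrite -[RHS](card_expr_fiber zeta8P y0); apply: eq_card => x; rewrite !inE.
rewrite -topredE /= andb_idl // => /eqP e.
by rewrite -(expf_neq0_pos x (isT : 0 < 8)%N) e expf_neq0.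
Qed.

Lemma card_octics : #|octics| = f.
Proof.
have := sum_octic (fun=> 1 : int).
rewrite !sumr_const cardF !natz => h.
lia.
Qed.

Let swap_pair (u : F * F) := (u.2, u.1).

Lemma diff_count_opp t : diff_count octics (- t) = diff_count octics t.
Proof.
rewrite /diff_count -(card_imset _ (can_inj (_ : involutive swap_pair))).
  2: by case.
apply: eq_card => -[a b]; rewrite !inE /=.
apply/imsetP/and3P => [[[c d]]|[aD bD e]].
  by rewrite !inE /= => /and3P[cD dD e] [-> ->]; rewrite dD cD -opprB eqr_oppLR.
by exists (b, a); rewrite // !inE /= bD aD -opprB eqr_opp.
Qed.

(** Division by [d2] sends a difference [d1 - d2 = t] to the octic residue
    [e = d1 / d2] with [e - 1 = t / d2]. *)
Lemma diff_count_scaled t : t != 0 ->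
  diff_count octics t = #|[set e in octics | (e - 1) / t \in octics]|.
Proof.
move=> t0; rewrite /diff_count; pose k (e : F) := (e * t / (e - 1), t / (e - 1)).
have d0 e : (e - 1) / t \in octics -> e - 1 != 0.
  by move/octics_neq0; apply: contra => /eqP->; rewrite mul0r.
rewrite -[RHS](card_in_imset (f := k)) => [|a b]; last first.
  rewrite !inE => /andP[_ /d0 a0] /andP[_ /d0 b0] [_] /(mulfI t0)/invr_inj.
  by apply: addIr.
apply: eq_card => -[a b]; rewrite inE /=.
apply/and3P/imsetP => [[aD bD /eqP e]|[e]].
  have b0 := octics_neq0 bD; have E : a / b - 1 = t / b by rewrite -e; field.
  exists (a / b).
    rewrite inE octics_div //= E mulrAC divff // -[1 / b]/(1 / b).
    by rewrite octics_div // octics1.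
  by rewrite /k E; congr (_, _); field; rewrite ?t0 ?b0.
rewrite inE => /andP[eD h] [-> ->]; have e0 := d0 _ h.
have bD : t / (e - 1) \in octics.
  by rewrite -[t / _]mul1r -invf_div octics_div ?octics1.
split => //; last by apply/eqP; field; rewrite e0.
have -> : e * t / (e - 1) = e / ((e - 1) / t) by field; rewrite e0 t0.
by rewrite octics_div.
Qed.

(** [t] and [- t] occur equally often, and together their conditions say that
    [(e - 1) / t] is a fourth power. *)
Lemma diff_count_psi t : t != 0 ->
  (2 * diff_count octics t = #|[set e in octics | psi ((1 - e) / t) == 1%R]|)%N.
Proof.
move=> t0; have t0' : - t != 0 by rewrite oppr_eq0.
rewrite mul2n -addnn -{2}diff_count_opp !diff_count_scaled //.
rewrite -cardsUI [X in (_ + X)%N](_ : _ = 0%N) ?addn0; last first.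
  apply/eqP; rewrite cards_eq0; apply/eqP/setP => e; rewrite !inE.
  rewrite invrN mulrN; apply/negP => /andP[/andP[_ /octics_opp/negPf->]].
  by rewrite andbF.
apply: eq_card => e; rewrite !inE -andb_orr; congr (_ && _).
rewrite invrN mulrN.
have [->|e1] := eqVneq e 1.
  rewrite subrr mul0r oppr0 psi0 eq_sym oner_eq0 orbb.
  by apply/negP => /octics_neq0/eqP.
rewrite -psi_octics ?mulf_neq0 ?invr_eq0 ?subr_eq0 //.
by rewrite -psiN -mulNr opprB.
Qed.

(** Fourier inversion on fourth power classes: [psi ((1 - e) / t) = 1] is
    expanded into powers of [psi], and the sum over [e] of each nontrivial power
    of [psi (1 - e)] is [s], one eighth of the sum over all nonzero [x] of its
    value at [1 - x^8]. *)
Lemma diff_count_octics (s : int) t :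
  \sum_x psi (1 - x ^+ 8) = (8 * s + 1)%:~R ->
  \sum_x phi (1 - x ^+ 8) = 8 * s + 1 -> t != 0 ->
  8 * (diff_count octics t)%:Z = f%:Z - 1 - s + 4 * s * (psi t == 1)%:Z.
Proof.
move=> S1 S2 t0.
have Sj j : (0 < j < 4)%N -> \sum_(e in octics) psi (1 - e) ^+ j = s%:~R.
  move=> hj; have : \sum_x psi (1 - x ^+ 8) ^+ j = (8 * s + 1)%:~R.
    case: j hj => [|[|[|[|j]]]] // _.
      by rewrite -S2 rmorph_sum /=; apply: eq_bigr => x _; rewrite phiE.
    rewrite -(conj_intr (intr_int _ (8 * s + 1))) -S1 rmorph_sum /=.
    by apply: eq_bigr => x _; rewrite psi_conj.
  rewrite (sum_octic (fun e => psi (1 - e) ^+ j)) subr0 psi1 expr1n.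
  rewrite rmorphD rmorphM /= addrC => /addIr/mulfI; apply.
  by rewrite pnatr_eq0.
have S4 : \sum_(e in octics) psi (1 - e) ^+ 4 = f%:R - 1.
  rewrite (bigD1 1) ?octics1 //= subrr psi0 expr0n add0r.
  rewrite (eq_bigr (fun=> 1)) => [|e /andP[_ e1]]; last first.
    by rewrite psi4 // subr_eq0 eq_sym.
  rewrite -card_octics (cardD1 1 (mem octics)) octics1 natrD addrAC subrr add0r.
  by rewrite sumr_const; congr _%:R; apply: eq_card => e; rewrite !inE andbC.
apply/intC_inj.
have -> : 8 * (diff_count octics t)%:Z =
          4 * #|[set e in octics | psi ((1 - e) / t) == 1]|%:Z.
  by rewrite -diff_count_psi //; lia.
transitivity (\sum_(1 <= j < 5)
    psi t^-1 ^+ j * \sum_(e in octics) psi (1 - e) ^+ j).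
  under eq_bigr do rewrite mulr_sumr.
  rewrite exchange_big /= rmorphM /= -pmulrn -sum1_card natr_sum mulr_sumr.
  rewrite big_mkcond /=.
  rewrite [RHS]big_mkcond; apply: eq_bigr => e _; rewrite inE.
  case: (boolP (e \in octics)) => eD /=; last by [].
  under eq_bigr do rewrite -exprMn -psiM mulrC.
  by rewrite psi_indicator; case: ifP => _ /=; ring.
have := psi_indicator t^-1.
rewrite !big_1_5 S4 !Sj // psi4 ?invr_eq0 // => h.
have -> : (psi t == 1) = (psi t^-1 == 1).
  have pt0 : psi t != 0 by rewrite psi_eq0.
  by rewrite -[RHS](inj_eq (mulfI pt0)) -psiM divff // psi1 mulr1 eq_sym.
rewrite intrD intrM !intrB intrM -!pmulrn.
transitivity ((psi t^-1 ^+ 1 + psi t^-1 ^+ 2 + psi t^-1 ^+ 3 + 1 - 1) * s%:~R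
              + (f%:R - 1)).
  by ring.
by rewrite h; ring.
Qed.

(** A common form of both parts: [s = 0] is type O and [s = -2] is type O0.
    Unique representation together with the congruences modulo 4 gives
    [u = 4 s + 1] and [X = 12 s + 3] with the right signs, which makes both
    character sums equal to [8 s + 1]. *)
Lemma diff_count_octics_norm_forms (s a b : int) t :
  prime (8 * f).+1 ->
  (8 * f).+1%:Z = (4 * s + 1) ^+ 2 + 8 * a ^+ 2 ->
  (8 * f).+1%:Z = (12 * s + 3) ^+ 2 + 64 * b ^+ 2 -> t != 0 ->
  8 * (diff_count octics t)%:Z = f%:Z - 1 - s + 4 * s * (psi t == 1)%:Z.
Proof.
move=> pP Ea Eb t0.
have [u [v [uE [k uk] un]]] := jacobsthal4_norm_form.
have [X [Y [XE [l Xl] Xn]]] := jacobsthal2_norm_form.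
have {un} us : u = 4 * s + 1.
  have /eqP : u ^+ 2 = (4 * s + 1) ^+ 2.
    apply: (norm_form_unique (k := 2) (b := v) (d := 2 * a) pP) => //.
    by rewrite Ea; ring.
  by rewrite eqf_sqr => /orP[/eqP|/eqP e]; last by clear -uk e; lia.
have {Xn} Xs : X = 12 * s + 3.
  have /eqP : X ^+ 2 = (12 * s + 3) ^+ 2.
    apply: (norm_form_unique (k := 4) (b := Y) (d := 4 * b) pP) => //.
    by rewrite Eb; ring.
  by rewrite eqf_sqr => /orP[/eqP|/eqP e]; last by clear -Xl e; lia.
(* 16 #|fermat_set| = 8 f - 10 + 6 X = X^2 + 6 X - 11 + 64 b^2
   = 144 s (s + 1) + 16 + 64 b^2, and s (s + 1) is even. *)
have p2 : psi 2 = 1.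
  apply: psi2_eq1.
  have [r rE] : exists r : int, s * (s + 1) = 2 * r.
    have [j [->|->]] : exists j, s = 2 * j \/ s = 2 * j + 1.
      by exists (s %/ 2)%Z; lia.
    - by exists (j * (2 * j + 1)); ring.
    - by exists ((2 * j + 1) * (j + 1)); ring.
  have : #|fermat_set|%:Z = 18 * r + 1 + 4 * b ^+ 2.
    apply: (@mulfI _ 16) => //; rewrite card_fermat_set XE Xs.
    have -> : (8 * f)%N%:Z = (12 * s + 3) ^+ 2 + 64 * b ^+ 2 - 1 by lia.
    have -> : 16 * (18 * r + 1 + 4 * b ^+ 2) = 144 * (2 * r) + 16 + 64 * b ^+ 2.
      by ring.
    by rewrite -rE; ring.
  by move: (b ^+ 2) => c; lia.
apply: diff_count_octics => //.
  by rewrite (sum_psi_octic_eval p2 uE) us; congr _%:~R; ring.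
by rewrite sum_phi_octic uE XE us Xs; ring.
Qed.

End Characters.

(** * Almost difference sets *)

Lemma almost_difference_set_of_counts (G : finZmodType) (D : {set G}) lam :
  (forall t, t != 0 -> diff_count D t = lam \/ diff_count D t = lam.+1) ->
  almost_difference_set D.
Proof.
move=> h; exists lam, #|[set t : G | (t != 0) && (diff_count D t == lam)]|.
by split=> // t /h[].
Qed.

Lemma diff_count_sum (G : finZmodType) (D : {set G}) t :
  diff_count D t = (\sum_(d in D) ((d + t)%R \in D))%N.
Proof.
rewrite /diff_count -big_mkcondr sum1_card.
rewrite -(card_imset (fun d => (d \in D) && (d + t \in D))
  (f := fun d => (d + t, d))).
  apply: eq_card => -[a b]; rewrite inE /=.
  apply/and3P/imsetP => [[aD bD /eqP <-]|[d]].
    by exists b; [rewrite unfold_in bD addrC subrK | rewrite addrC subrK].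
  by rewrite unfold_in => /andP[dD dtD] [-> ->]; rewrite addrAC subrr add0r.
by move=> a b [].
Qed.

(** The new pairs are [(t, 0)] and [(0, - t)]. *)
Lemma diff_count_setU0 (G : finZmodType) (D : {set G}) t :
  0 \notin D -> t != 0 ->
  diff_count (0 |: D) t = (diff_count D t + (t \in D) + (- t \in D))%N.
Proof.
move=> D0 t0; rewrite !diff_count_sum big_setU1 //= add0r !inE (negPf t0) /=.
rewrite addnAC addnC; congr (_ + _)%N.
have -> : (- t \in D : nat) = (\sum_(d in D) (d == (- t)%R))%N.
  rewrite -big_mkcondr sum1_card; case: (boolP (- t \in D)) => tD.
    rewrite (@eq_card1 _ (- t)) // => d.
    by rewrite unfold_in inE andb_idl // => /eqP->.
  rewrite eq_card0 // => d; rewrite unfold_in inE.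
  by apply: contraNF tD => /andP[] /[swap] /eqP->.
rewrite -big_split; apply: eq_bigr => d dD; rewrite !inE -addr_eq0 /=.
by case: eqP => [->|]; rewrite ?(negPf D0) ?addn0.
Qed.

(** Transfer to the prime field; [p = 9 %[mod 16]] says that [f = (p - 1) / 8] is
    odd. *)
Lemma octic_residues_counts (p : nat) (s a b : int) :
  prime p -> p = 9 %[mod 16] ->
  p%:Z = (4 * s + 1) ^+ 2 + 8 * a ^+ 2 ->
  p%:Z = (12 * s + 3) ^+ 2 + 64 * b ^+ 2 ->
  exists m : int, forall t : 'F_p, t != 0 ->
    8 * (diff_count (octic_residues p) t)%:Z =
    m + 4 * s * ((t \in octic_residues p) || (- t \in octic_residues p))%:Z.
Proof.
move=> pP p9 Ea Eb.
have [f pE f_odd] : exists2 f, p = (8 * f).+1 & odd f.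
  by exists (p %/ 8)%N; lia.
have cardF : #|'F_p| = (8 * f).+1 by rewrite card_Fp.
have [g gP] := finField_prim_root 'F_p; rewrite cardF /= in gP.
exists (f%:Z - 1 - s) => t t0; rewrite pE in pP Ea Eb.
rewrite -(psi_octics cardF f_odd gP t0).
exact: (diff_count_octics_norm_forms cardF f_odd gP pP Ea Eb t0).
Qed.

Lemma octic_residues_disjoint (p : nat) (t : 'F_p) :
  prime p -> p = 9 %[mod 16] ->
  t \in octic_residues p -> - t \notin octic_residues p.
Proof.
move=> pP p9.
have [f pE f_odd] : exists2 f, p = (8 * f).+1 & odd f.
  by exists (p %/ 8)%N; lia.
have cardF : #|'F_p| = (8 * f).+1 by rewrite card_Fp.
have [g gP] := finField_prim_root 'F_p; rewrite cardF /= in gP.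
exact: octics_opp cardF f_odd gP t.
Qed.

Lemma octic_residues0 p : 0 \notin octic_residues p.
Proof. by apply/negP => /octics_neq0; rewrite eqxx. Qed.

Lemma octic_residues1 p : 1 \in octic_residues p.
Proof. exact: octics1. Qed.

Theorem theorem8 :
  (forall (p : nat) (a b : int),
     prime p -> ~~ (2 %| a)%Z -> ~~ (2 %| b)%Z ->
     p%:Z = 8 * a ^+ 2 + 1 -> p%:Z = 64 * b ^+ 2 + 9 ->
     almost_difference_set (0 |: type_O p))
  /\
  (forall (p : nat) (a b : int),
     prime p -> ~~ (2 %| a)%Z -> (2 %| b)%Z ->
     p%:Z = 8 * a ^+ 2 + 49 -> p%:Z = 64 * b ^+ 2 + 441 ->
     almost_difference_set (type_O0 p :\ 0)).
Proof.
(* An odd square is 1 modulo 8, which puts p in the class of 9 modulo 16. *)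
have odd_sqr (a : int) :
    ~~ (2 %| a)%Z -> exists c, a ^+ 2 = 4 * c + 1 /\ (2 %| c)%Z.
  move=> a2; have [k ->] : exists k, a = 2 * k + 1 by exists (a %/ 2)%Z; lia.
  exists (k * (k + 1)); split; first by ring.
  by rewrite dvdzE abszM Euclid_dvdM //; lia.
split=> p a b pP /odd_sqr[c [aE c2]] _ Ea Eb.
  have p9 : p = 9 %[mod 16] by move: Ea; rewrite aE; lia.
  have [||m mE] := @octic_residues_counts p 0 a b pP p9.
  - by rewrite Ea; ring.
  - by rewrite Eb; ring.
  apply: almost_difference_set_of_counts (diff_count (octic_residues p) 1) _.
  move=> t t0; rewrite (diff_count_setU0 (octic_residues0 p) t0).
  have -> : diff_count (octic_residues p) t = diff_count (octic_residues p) 1.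
    by have := mE t t0; have := mE 1 (oner_neq0 _); lia.
  (* All counts of D agree; those of 0 |: D exceed them by 1 at t = +-d. *)
  have := @octic_residues_disjoint p t pP p9.
  case: (t \in _) => [/(_ isT)/negPf->|_]; first by right; rewrite addn0 addn1.
  by case: (- t \in _); [right; rewrite addn0 addn1|left; rewrite !addn0].
have p9 : p = 9 %[mod 16] by move: Ea; rewrite aE; lia.
have [||m mE] := @octic_residues_counts p (-2) a b pP p9.
- by rewrite Ea; ring.
- by rewrite Eb; ring.
(* Without 0 the counts are smaller by 1 exactly at t = +-d, such as t = 1. *)
rewrite /type_O0 setU1K ?octic_residues0 //.
apply: almost_difference_set_of_counts (diff_count (octic_residues p) 1) _.
move=> t t0; have := mE t t0; have := mE 1 (oner_neq0 _).
by rewrite octic_residues1 orTb; case: (_ || _); lia.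
Qed.
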